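(* Let $m,n,k\ge 1$ be integers and let $A_1,\dots,A_k\in\mathbb{R}^{m\times n}$. Let $M=[A_1,\dots,A_k]\in\mathbb{R}^{m\times kn}$ be their horizontal concatenation and let $r=\operatorname{rank}(M)$. Let $\widetilde A_1,\dots,\widetilde A_k\in\mathbb{R}^{m\times n}$, let $\widetilde M=[\widetilde A_1,\dots,\widetilde A_k]\in\mathbb{R}^{m\times kn}$, and set $E_j=\widetilde A_j-A_j$ for $j=1,\dots,k$. Then: (1) for every $i=1,\dots,r$, \[ |\sigma_i(\widetilde M)-\sigma_i(M)|\le \frac{1}{\sigma_i(M)}\sum_{j=1}^k\bigl(2\|A_j\|_2\|E_j\|_2+\|E_j\|_2^2\bigr); \] (2) for every $i=r+1,\dots,\min(m,kn)$, \[ \sigma_i(\widetilde M)\le\sqrt{\sum_{j=1}^k\bigl(2\|A_j\|_2\|E_j\|_2+\|E_j\|_2^2\bigr)}. \]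
   Context: $\|\cdot\|_2$ denotes the spectral (operator) norm of a matrix. For $X\in\mathbb{R}^{p\times q}$, $\sigma_1(X)\ge\sigma_2(X)\ge\dots\ge\sigma_{\min(p,q)}(X)\ge 0$ denote its singular values in non-increasing order, counted with multiplicity (so $\sigma_i(X)>0$ iff $i\le\operatorname{rank}(X)$). *)

(* Defs.v *)
From mathcomp Require Import all_boot all_order all_algebra.
From mathcomp Require Import polyrcf.
From mathcomp Require Import classical_sets reals.

Set Implicit Arguments.
Unset Strict Implicit.
Unset Printing Implicit Defensive.

Import Order.TTheory GRing.Theory Num.Theory.
Local Open Scope classical_set_scope.
Local Open Scope ring_scope.

Definition l2norm (R : realType) (p : nat) (x : 'cV[R]_p) : R :=
  Num.sqrt (\sum_(i < p) x i 0 ^+ 2).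

(* The set below contains 0 and is bounded above, so [sup] is a genuine
   supremum. *)
Definition opnorm (R : realType) (p q : nat) (X : 'M[R]_(p, q)) : R :=
  sup [set l2norm (X *m x) | x in [set x : 'cV[R]_q | l2norm x <= 1]].

(* [rootsR] lists each real root once, hence the repetition by [mup]. *)
Definition eigenvalues (R : realType) (p : nat) (S : 'M[R]_p) : seq R :=
  sort >=%R
    (flatten [seq nseq (mup a (char_poly S)) a | a <- rootsR (char_poly S)]).

Definition singular_values (R : realType) (p q : nat) (X : 'M[R]_(p, q)) :
    seq R :=
  take (minn p q) [seq Num.sqrt a | a <- eigenvalues (X *m X^T)].

(* One-based: [sigma 1 X] is the largest singular value. Indices outside
   [1 .. minn p q] carry no meaning. *)
Definition sigma (R : realType) (p q : nat) (i : nat) (X : 'M[R]_(p, q)) : R :=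
  nth 0 (singular_values X) i.-1.

(* Main.v *)
(* Let S = M M^T and St = Mt Mt^T, so that sigma_i^2 are the eigenvalues of S
   and St. The block form S = sum_j A_j A_j^T gives
   |x (St - S) x^T| <= delta |x|^2 for every row vector x, hence Weyl's
   inequality gives |lambda_i(St) - lambda_i(S)| <= delta; the spectral theorem
   behind it is applied over R[i], real quadratic forms being extended to
   complex vectors by splitting into real and imaginary parts. If i <= rank M
   then sigma_i(M) > 0 and one divides by
   sigma_i(Mt) + sigma_i(M) >= sigma_i(M); if i > rank M then
   lambda_i(S) = 0 and one takes square roots. *)
Require Import Defs.
From mathcomp Require Import all_boot all_order all_algebra.
From mathcomp Require Import polyrcf complex.
From mathcomp Require Import classical_sets reals.
From mathcomp Require Import ring zify.

Set Implicit Arguments.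
Unset Strict Implicit.
Unset Printing Implicit Defensive.

Import Order.TTheory GRing.Theory Num.Theory.
Local Open Scope ring_scope.
Local Open Scope sesquilinear_scope.

(** * Spectral decomposition of real symmetric matrices *)

Lemma char_poly_similar (F : comUnitRingType) m (P D S : 'M[F]_m) :
  P \in unitmx -> S = invmx P *m D *m P -> char_poly S = char_poly D.
Proof.
move=> uP ->; set Pp := map_mx polyC P; set Qp := map_mx polyC (invmx P).
have QP : Qp *m Pp = 1%:M by rewrite -map_mxM mulVmx // map_mx1.
rewrite /char_poly /char_poly_mx !map_mxM -/Pp -/Qp.
have -> : 'X%:M - Qp *m map_mx polyC D *m Pp
       = Qp *m ('X%:M - map_mx polyC D) *m Pp.
  by rewrite mulmxBr mulmxBl mul_mx_scalar -scalemxAl QP scalemx1.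
by rewrite !det_mulmx mulrAC -det_mulmx QP det1 mul1r.
Qed.

(** Phrased with a list so that it can be transported to [eigenvalues] along a permutation; the
    induction splits off a 1 x 1 block. *)
Lemma rank_diag_mx (F : fieldType) m (d : 'rV[F]_m) :
  \rank (diag_mx d) = count (predC1 0) [seq d 0 i | i <- enum 'I_m].
Proof.
elim: m d => [|m IHm] d.
  by rewrite (flatmx0 (diag_mx d)) mxrank0; case: (fintype.enum _) => [|[]].
have -> : \rank (diag_mx d) = (\rank (diag_mx (@lsubmx _ 1 1 m d))
                               + \rank (diag_mx (@rsubmx _ 1 1 m d)))%N.
  by rewrite -rank_diag_block_mx -diag_mx_row hsubmxK.
rewrite IHm.
rewrite enum_ordSl /= -map_comp; congr (_ + _)%N.
  have -> : diag_mx (@lsubmx _ 1 1 m d) = (d 0 0)%:M.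
    apply/matrixP => i j; rewrite !mxE !ord1; congr (d _ _ *+ _).
    exact/val_inj.
  have [->|d0] := eqVneq (d 0 0) 0; first by rewrite raddf0 mxrank0.
  by rewrite -scalemx1 mxrank_scale_nz // mxrank1.
congr count; apply: eq_map => i /=; rewrite mxE; congr (d _ _).
exact/val_inj.
Qed.

(** A real symmetric matrix is Hermitian over [R[i]], hence normal with real spectral diagonal: the
    diagonal descends to [R] while [P] stays complex. *)
Lemma symmetric_spectral (R : rcfType) m (S : 'M[R]_m) : S^T = S ->
  exists d : 'rV[R]_m, exists2 P : 'M[R[i]]_m, P \is unitarymx &
    map_mx (real_complex R) S =
      P^t* *m diag_mx (map_mx (real_complex R) d) *m P.
Proof.
move=> symS; set Sc := map_mx (real_complex R) S.
have hS : Sc \is hermsymmx.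
  apply/is_hermitianmxP; rewrite expr0 scale1r; apply/matrixP => i j.
  rewrite !mxE -[S in RHS]symS mxE; apply/esym/CrealP.
  by rewrite complex_real.
have /mxOverP real_d := hermitian_spectral_diag_real hS.
have /orthomx_spectralP eqS := hermitian_normalmx hS.
exists (map_mx (@complex.Re R) (spectral_diag Sc)), (spectralmx Sc).
  exact: spectral_unitarymx.
rewrite -invmx_unitary ?spectral_unitarymx // -map_mx_comp.
rewrite [LHS]eqS; congr (_ *m diag_mx _ *m _).
by apply/rowP => i; rewrite !mxE /= RRe_real.
Qed.

(** By similarity the characteristic polynomial is the product of the ['X - d_i], so root
    multiplicities are numbers of occurrences in [d]. *)
Lemma eigenvalues_spectral (R : realType) m (S : 'M[R]_m) (d : 'rV[R]_m)
    (P : 'M[R[i]]_m) : P \is unitarymx ->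
  map_mx (real_complex R) S =
    P^t* *m diag_mx (map_mx (real_complex R) d) *m P ->
  perm_eq (eigenvalues S) [seq d 0 i | i <- enum 'I_m].
Proof.
move=> uP eqS.
have chS : char_poly S = \prod_(a <- [seq d 0 i | i <- enum 'I_m]) ('X - a%:P).
  apply: (map_poly_inj (real_complex R)).
  rewrite map_char_poly -invmx_unitary // in eqS *.
  rewrite (char_poly_similar (unitarymx_unit uP) eqS).
  rewrite char_poly_trig ?diag_mx_is_trig // big_map big_enum rmorph_prod.
  apply: eq_bigr => i _ /=.
  by rewrite !mxE eqxx mulr1n rmorphB /= map_polyX map_polyC.
rewrite /eigenvalues perm_sort; apply/allP => a _ /=; apply/eqP.
have nz : char_poly S != 0 by rewrite monic_neq0 // char_poly_monic.
rewrite -[RHS]mu_prod_XsubC -chS.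
(* The root list has no duplicates, so each root occurs in the flattened list exactly as often as
   its multiplicity. *)
have cntE (s : seq R) (f : R -> nat) : uniq s ->
    count_mem a (flatten [seq nseq (f b) b | b <- s])
      = if a \in s then f a else 0%N.
  elim: s => //= b s IHs /andP[bs us]; rewrite count_cat count_nseq IHs //=.
  rewrite inE eq_sym; have [->|] /= := eqVneq a b; last by rewrite mul0n.
  by rewrite (negPf bs) mul1n addn0.
rewrite cntE ?uniq_roots //; case: ifPn => // aS; rewrite mupNroot //.
apply: contra aS => aS.
by have /roots_on_rootsR/(_ a) := nz; rewrite aS andbT => <-.
Qed.

(** * Comparing quadratic forms on spans of eigenvectors *)

(** For [z = x + 'i y] the symmetry of [D] cancels the cross terms, leaving the sum of the real
    forms at [x] and [y]. *)
Lemma complex_form_ge0 (R : rcfType) m (D : 'M[R]_m) : D^T = D ->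
  (forall x : 'rV[R]_m, 0 <= (x *m D *m x^T) 0 0) ->
  forall z : 'rV[R[i]]_m, 0 <= (z *m map_mx (real_complex R) D *m z^t*) 0 0.
Proof.
move=> symD D_ge0 z; set Dc := map_mx _ D.
pose x := map_mx (@complex.Re R) z; pose y := map_mx (@complex.Im R) z.
pose xc := map_mx (real_complex R) x; pose yc := map_mx (real_complex R) y.
have zE : z = xc + 'i%C *: yc.
  by apply/rowP => i; rewrite !mxE -complexE.
have zcE : z^t* = xc^T - 'i%C *: yc^T.
  apply/matrixP => i j; rewrite !mxE; case: (z j i) => a b.
  change (Num.conj (a +i* b)%C) with (a -i* b)%C.
  by apply/eqP; rewrite eq_complex /=; apply/andP; split; apply/eqP; ring.
have yx : yc *m Dc *m xc^T = xc *m Dc *m yc^T.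
  rewrite !(map_trmx (real_complex R)) -!map_mxM; congr map_mx.
  transitivity ((y *m D *m x^T)^T); last by rewrite !trmx_mul symD trmxK mulmxA.
  by apply/matrixP => i j; rewrite !ord1 [RHS]mxE.
have -> : z *m Dc *m z^t* =
    map_mx (real_complex R) (x *m D *m x^T + y *m D *m y^T).
  rewrite zcE {1}zE !mulmxBr !mulmxDl -!scalemxAl -!scalemxAr.
  rewrite yx scalerA -expr2 sqr_i scaleN1r opprD opprK.
  by rewrite addrA addrK map_mxD !map_mxM -!(map_trmx (real_complex R)).
by rewrite mxE lecR mxE addr_ge0.
Qed.

(** Selected rows of a unitary matrix are still orthonormal, hence independent. *)
Lemma rank_rowsub_unitary (C : numClosedFieldType) m (P : 'M[C]_m)
    (I : {pred 'I_m}) : P \is unitarymx ->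
  \rank (rowsub (enum_val (A := I)) P) = #|I|.
Proof.
move=> uP; apply: mxrank_unitary; apply/unitarymxP/matrixP => i j.
rewrite [RHS]mxE -(inj_eq enum_val_inj i j).
have /matrixP/(_ (enum_val i) (enum_val j)) := unitarymxP uP.
by rewrite !mxE => <-; apply: eq_bigr => k _; rewrite !mxE.
Qed.

(** [v *m P^t*] lists the coordinates of [v] in the orthonormal basis formed by the rows of [P]. *)
Lemma rowsub_unitary_coord0 (C : numClosedFieldType) m (P : 'M[C]_m)
    (I : {pred 'I_m}) (v : 'rV[C]_m) i : P \is unitarymx ->
  (v <= rowsub (enum_val (A := I)) P)%MS -> i \notin I -> (v *m P^t*) 0 i = 0.
Proof.
move=> uP /submxP[w ->] iI; rewrite -mulmxA mul_rowsub_mx (unitarymxP uP) mxE.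
apply: big1 => k _; rewrite !mxE; case: eqP => [ki|]; last by rewrite mulr0.
by rewrite -ki enum_valP in iI.
Qed.

Lemma unitary_diag_form (C : numClosedFieldType) m (P : 'M[C]_m)
    (d v : 'rV[C]_m) :
  (v *m (P^t* *m diag_mx d *m P) *m v^t*) 0 0 =
    \sum_i d 0 i * `|(v *m P^t*) 0 i| ^+ 2.
Proof.
set u := v *m P^t*.
have -> : v *m (P^t* *m diag_mx d *m P) *m v^t* = u *m diag_mx d *m u^t*.
  by rewrite /u trmx_mul map_mxM trmxCK !mulmxA.
rewrite mxE; apply: eq_bigr => i _.
by rewrite mul_mx_diag !mxE normCK mulrCA mulrA.
Qed.

(* Spans of eigenvectors of [S] and [T] of total dimension exceeding [m] meet in
   a nonzero vector, on which the two quadratic forms are compared. *)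
Lemma spectral_count_le (R : rcfType) m (S T : 'M[R]_m) (d e : 'rV[R]_m)
    (P Q : 'M[R[i]]_m) (a b delta : R) :
  S^T = S -> T^T = T -> P \is unitarymx -> Q \is unitarymx ->
  map_mx (real_complex R) S =
    P^t* *m diag_mx (map_mx (real_complex R) d) *m P ->
  map_mx (real_complex R) T =
    Q^t* *m diag_mx (map_mx (real_complex R) e) *m Q ->
  (forall x : 'rV[R]_m,
    (x *m S *m x^T) 0 0 <= (x *m T *m x^T) 0 0 + delta * (x *m x^T) 0 0) ->
  (m < #|[pred i | (a <= d 0 i)%R]| + #|[pred i | (e 0 i <= b)%R]|)%N ->
  a <= b + delta.
Proof.
move=> symS symT uP uQ eqS eqT leST.
set I := [pred i | _]; set J := [pred i | (e 0 i <= b)%R] => ltm.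
pose U := rowsub (enum_val (A := I)) P; pose W := rowsub (enum_val (A := J)) Q.
have /rowV0Pn[v] : (U :&: W)%MS != 0.
  rewrite -mxrank_eq0 -lt0n -(ltn_add2l (\rank (U + W)%MS)) addn0.
  rewrite mxrank_sum_cap !rank_rowsub_unitary //.
  exact: leq_ltn_trans (rank_leq_col _) ltm.
rewrite sub_capmx => /andP[vU vW] v0.
pose rc := real_complex R.
(* The hypothesis speaks of real vectors, whereas [v] is complex; nonnegativity of the form of
   [T + delta%:M - S] carries it over. *)
have symD : (T + delta%:M - S)^T = T + delta%:M - S.
  by rewrite linearB linearD /= symS symT tr_scalar_mx.
have D_ge0 (x : 'rV[R]_m) : 0 <= (x *m (T + delta%:M - S) *m x^T) 0 0.
  rewrite mulmxBr mulmxDr mul_mx_scalar mulmxBl mulmxDl -scalemxAl.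
  by rewrite mxE [X in X + _]mxE [X in _ + X + _]mxE [X in _ + X]mxE subr_ge0.
have := complex_form_ge0 symD D_ge0 v.
rewrite map_mxB map_mxD map_scalar_mx -/rc.
rewrite mulmxBr mulmxDr mul_mx_scalar mulmxBl mulmxDl -scalemxAl.
rewrite mxE [X in X + _]mxE [X in _ + X + _]mxE [X in _ + X]mxE subr_ge0.
rewrite /rc eqS eqT !unitary_diag_form.
have normE (B : 'M[R[i]]_m) : B \is unitarymx ->
    (v *m v^t*) 0 0 = \sum_i `|(v *m B^t*) 0 i| ^+ 2.
  move=> uB.
  transitivity ((v *m (B^t* *m diag_mx (const_mx 1) *m B) *m v^t*) 0 0).
    rewrite diag_const_mx mulmx1 -invmx_unitary // mulVmx ?mulmx1 //.
    exact: unitarymx_unit.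
  by rewrite unitary_diag_form; apply: eq_bigr => i _; rewrite mxE mul1r.
have v_gt0 : 0 < (v *m v^t*) 0 0 by rewrite -dotmxE dotmx_is_dotmx.
(* The chain is a |v|^2 <= S(v) <= T(v) + delta |v|^2 <= (b + delta) |v|^2; its ends hold because
   [v] has coordinates only in [I] for [P] and only in [J] for [Q]. *)
move=> le_ST; rewrite -lecR -(ler_pM2r v_gt0) rmorphD mulrDl /=.
apply: le_trans (le_trans le_ST _); last rewrite lerD2r.
  rewrite (normE P uP) mulr_sumr; apply: ler_sum => i _.
  have [iI|iI] := boolP (i \in I); last first.
    by rewrite (rowsub_unitary_coord0 uP vU iI) normr0 expr0n !mulr0.
  by rewrite ler_wpM2r ?exprn_ge0 // mxE lecR.
rewrite (normE Q uQ) mulr_sumr; apply: ler_sum => i _.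
have [iJ|iJ] := boolP (i \in J); last first.
  by rewrite (rowsub_unitary_coord0 uQ vW iJ) normr0 expr0n !mulr0.
by rewrite ler_wpM2r ?exprn_ge0 // mxE lecR.
Qed.

(** * Sorted eigenvalue lists and Weyl's inequality *)

(** Positions start at 0: the [i.+1] entries up to position [i] all qualify. *)
Lemma sorted_count_ge (R : realDomainType) (s : seq R) i :
  sorted >=%R s -> (i < size s)%N -> (i < count (>= nth 0%R s i)%R s)%N.
Proof.
move=> ss lti; have ge_trans : transitive (>=%R : rel R).
  by move=> x y z yx xz; apply: le_trans xz yx.
apply: (@leq_trans (count (>= nth 0%R s i)%R (take i.+1 s))).
  rewrite -[i.+1 in X in (X <= _)%N](size_takel lti).
  rewrite leq_eqVlt eq_sym -all_count.
  apply/orP; left; apply/(all_nthP 0) => j; rewrite size_takel // ltnS => ji.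
  rewrite nth_take //=.
  by have := sorted_leq_nth ge_trans lexx 0 ss j i; apply => //;
     rewrite inE // (leq_ltn_trans ji).
by rewrite -[X in (_ <= count _ X)%N](cat_take_drop i.+1) count_cat leq_addr.
Qed.

Lemma sorted_count_le (R : realDomainType) (s : seq R) i :
  sorted >=%R s -> (size s - i <= count (<= nth 0%R s i)%R s)%N.
Proof.
move=> ss; have ge_trans : transitive (>=%R : rel R).
  by move=> x y z yx xz; apply: le_trans xz yx.
apply: (@leq_trans (count (<= nth 0%R s i)%R (drop i s))); last first.
  by rewrite -[X in (_ <= count _ X)%N](cat_take_drop i) count_cat leq_addl.
rewrite -size_drop leq_eqVlt eq_sym -all_count.
apply/orP; left; apply/(all_nthP 0) => j; rewrite size_drop ltn_subRL => ji.
rewrite nth_drop /=.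
by have := sorted_leq_nth ge_trans lexx 0 ss i (i + j)%N; apply => //;
  rewrite ?inE ?leq_addr // (leq_ltn_trans _ ji) // leq_addr.
Qed.

Lemma eigenvalues_sorted (R : realType) m (S : 'M[R]_m) :
  sorted >=%R (eigenvalues S).
Proof. by apply: sort_sorted => x y; apply: le_total. Qed.

Lemma size_eigenvalues (R : realType) m (S : 'M[R]_m) : S^T = S ->
  size (eigenvalues S) = m.
Proof.
move=> /symmetric_spectral[d [P uP eqS]].
by rewrite (perm_size (eigenvalues_spectral uP eqS)) size_map size_enum_ord.
Qed.

(** At least [i + 1] eigenvalues of [S] are no smaller than its entry [i], and at least [m - i] of
    [T] no larger than its own; the total [m + 1] exceeds the dimension. *)
Lemma eigenvalues_le (R : realType) m (S T : 'M[R]_m) (delta : R) i :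
  S^T = S -> T^T = T ->
  (forall x : 'rV[R]_m,
    (x *m S *m x^T) 0 0 <= (x *m T *m x^T) 0 0 + delta * (x *m x^T) 0 0) ->
  (i < m)%N ->
  nth 0 (eigenvalues S) i <= nth 0 (eigenvalues T) i + delta.
Proof.
move=> symS symT leST im.
have [d [P uP eqS]] := symmetric_spectral symS.
have [e [Q uQ eqT]] := symmetric_spectral symT.
apply: (spectral_count_le symS symT uP uQ eqS eqT leST).
have count_coord (f : 'rV[R]_m) (p : pred R) :
    #|[pred j | p (f 0 j)]| = count p [seq f 0 j | j <- enum 'I_m].
  rewrite count_map cardE size_filter enumT; exact: eq_count.
rewrite (count_coord d (>= nth 0 (eigenvalues S) i)).
rewrite (count_coord e (<= nth 0 (eigenvalues T) i)).
rewrite -(permP (eigenvalues_spectral uP eqS)).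
rewrite -(permP (eigenvalues_spectral uQ eqT)).
have := sorted_count_ge (eigenvalues_sorted S) (i := i).
have := sorted_count_le i (eigenvalues_sorted T).
rewrite !size_eigenvalues // => cT /(_ im) cS.
by apply: leq_trans (leq_add cS cT); lia.
Qed.

(** * Euclidean norm and operator norm *)

Lemma l2norm_ge0 (R : realType) p (x : 'cV[R]_p) : 0 <= l2norm x.
Proof. exact: sqrtr_ge0. Qed.

Lemma sqr_l2norm (R : realType) p (x : 'cV[R]_p) :
  l2norm x ^+ 2 = (x^T *m x) 0 0.
Proof.
rewrite sqr_sqrtr ?sumr_ge0 // => [|i _]; last exact: sqr_ge0.
by rewrite mxE; apply: eq_bigr => i _; rewrite mxE expr2.
Qed.

Lemma l2norm_eq0 (R : realType) p (x : 'cV[R]_p) : l2norm x = 0 -> x = 0.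
Proof.
move=> x0; have : \sum_i x i 0 ^+ 2 = 0.
  rewrite -[LHS]sqr_sqrtr ?sumr_ge0 // => [|i _]; last exact: sqr_ge0.
  by rewrite -/(l2norm x) x0 expr0n.
move/psumr_eq0P => x2; apply/colP => i; rewrite mxE; apply/eqP.
by rewrite -sqrf_eq0 x2 // => j _; apply: sqr_ge0.
Qed.

Lemma l2normZ (R : realType) p (a : R) (x : 'cV[R]_p) :
  l2norm (a *: x) = `|a| * l2norm x.
Proof.
rewrite /l2norm -sqrtr_sqr -sqrtrM ?sqr_ge0 // mulr_sumr; congr Num.sqrt.
by apply: eq_bigr => i _; rewrite mxE exprMn.
Qed.

Lemma trmulmxC (R : comPzRingType) p (x y : 'cV[R]_p) :
  (y^T *m x) 0 0 = (x^T *m y) 0 0.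
Proof. by rewrite !mxE; apply: eq_bigr => i _; rewrite !mxE mulrC. Qed.

Lemma sqr_l2normD (R : realType) p (x y : 'cV[R]_p) :
  l2norm (x + y) ^+ 2 = l2norm x ^+ 2 + 2 * (x^T *m y) 0 0 + l2norm y ^+ 2.
Proof.
rewrite !sqr_l2norm !mxE mulr_sumr -!big_split /=.
by apply: eq_bigr => i _; rewrite !mxE; ring.
Qed.

Lemma cauchy_schwarz (R : realType) p (x y : 'cV[R]_p) :
  `|(x^T *m y) 0 0| <= l2norm x * l2norm y.
Proof.
have [x0|x_neq0] := eqVneq (l2norm x) 0.
  by rewrite x0 mul0r (l2norm_eq0 x0) trmx0 mul0mx mxE normr0.
have x_gt0 : 0 < l2norm x by rewrite lt_def x_neq0 l2norm_ge0.
rewrite -(@ler_pXn2r _ 2) ?nnegrE ?mulr_ge0 ?l2norm_ge0 //.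
rewrite real_normK ?num_real // exprMn.
set b := (x^T *m y) 0 0.
(* Expanding this square gives |x|^2 (|x|^2 |y|^2 - b^2). *)
have := sqr_ge0 (l2norm (l2norm x ^+ 2 *: y + (- b) *: x)).
rewrite sqr_l2normD !l2normZ -scalemxAr mxE linearZ /= -scalemxAl mxE.
rewrite trmulmxC -/b.
rewrite normrN !exprMn !real_normK ?num_real // => h.
rewrite -subr_ge0 -(pmulr_rge0 _ (exprn_gt0 2 x_gt0)).
by apply: le_trans h _; rewrite le_eqVlt; apply/orP; left; apply/eqP; ring.
Qed.

Lemma opnorm_set_bounded (R : realType) p q (X : 'M[R]_(p, q)) :
  has_ubound
    [set l2norm (X *m x) | x in [set x : 'cV[R]_q | l2norm x <= 1]]%classic.
Proof.
(* The bound is the Frobenius norm of [X]; Cauchy-Schwarz is applied to each row. *)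
exists (Num.sqrt (\sum_i l2norm (row i X)^T ^+ 2)) => _ [x /= x1 <-].
apply: ler_wsqrtr; apply: ler_sum => i _.
have -> : (X *m x) i 0 = (((row i X)^T)^T *m x) 0 0.
  by rewrite trmxK -row_mul [RHS]mxE.
rewrite -real_normK ?num_real //.
apply: lerXn2r; rewrite ?nnegrE ?l2norm_ge0 //.
apply: le_trans (cauchy_schwarz _ _) _.
by rewrite ler_piMr ?l2norm_ge0.
Qed.

Lemma opnorm_ge0 (R : realType) p q (X : 'M[R]_(p, q)) : 0 <= opnorm X.
Proof.
apply: le_trans (l2norm_ge0 (X *m 0)) _.
apply: (ub_le_sup (opnorm_set_bounded X)); exists 0 => //=.
by rewrite -(scale0r (0 : 'cV[R]_q)) l2normZ normr0 mul0r.
Qed.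

Lemma l2norm_mulmx (R : realType) p q (X : 'M[R]_(p, q)) (x : 'cV[R]_q) :
  l2norm (X *m x) <= opnorm X * l2norm x.
Proof.
have [x0|x_neq0] := eqVneq (l2norm x) 0.
  rewrite (l2norm_eq0 x0) mulmx0 -(l2norm_eq0 x0).
  by rewrite -[X in l2norm X <= _](scale0r (0 : 'cV[R]_p)) l2normZ normr0 mul0r
     mulr_ge0 ?opnorm_ge0 ?l2norm_ge0.
have x_gt0 : 0 < l2norm x by rewrite lt_def x_neq0 l2norm_ge0.
rewrite -ler_pdivrMr // mulrC -[_^-1]ger0_norm ?invr_ge0 ?l2norm_ge0 //.
rewrite -l2normZ scalemxAr.
apply: (ub_le_sup (opnorm_set_bounded X)); exists ((l2norm x)^-1 *: x) => //=.
by rewrite l2normZ ger0_norm ?invr_ge0 ?l2norm_ge0 // mulVf.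
Qed.

(** Serves the form of [X *m X^T], which involves [X^T]. With [y = X^T x], |y|^2 = <X y, x> is at
    most [opnorm X] times |y| |x|, and |y| cancels. *)
Lemma l2norm_trmulmx (R : realType) p q (X : 'M[R]_(p, q)) (x : 'cV[R]_p) :
  l2norm (X^T *m x) <= opnorm X * l2norm x.
Proof.
set y := X^T *m x.
have [y0|y_neq0] := eqVneq (l2norm y) 0.
  by rewrite y0 mulr_ge0 ?opnorm_ge0 ?l2norm_ge0.
have y_gt0 : 0 < l2norm y by rewrite lt_def y_neq0 l2norm_ge0.
rewrite -(ler_pM2l y_gt0) -expr2 sqr_l2norm {2}/y mulmxA -trmx_mul.
apply: le_trans (ler_norm _) _; apply: le_trans (cauchy_schwarz _ _) _.
by rewrite mulrA ler_wpM2r ?l2norm_ge0 // mulrC l2norm_mulmx.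
Qed.

(** * Gram matrices: quadratic form, rank and eigenvalues *)

Lemma gram_form (R : realType) p q (X : 'M[R]_(p, q)) (x : 'rV[R]_p) :
  (x *m (X *m X^T) *m x^T) 0 0 = l2norm (X^T *m x^T) ^+ 2.
Proof. by rewrite sqr_l2norm trmx_mul !trmxK !mulmxA. Qed.

Lemma gram_sym (R : comPzRingType) p q (X : 'M[R]_(p, q)) :
  (X *m X^T)^T = X *m X^T.
Proof. by rewrite trmx_mul trmxK. Qed.

(** Source of one summand of [delta]: the increment is 2 <u, w> + |w|^2, with Cauchy-Schwarz for the
    cross term. *)
Lemma sqr_l2normD_bound (R : realType) p q (X Y : 'M[R]_(p, q))
    (x : 'cV[R]_p) :
  `|l2norm ((X + Y)^T *m x) ^+ 2 - l2norm (X^T *m x) ^+ 2|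
    <= (2 * opnorm X * opnorm Y + opnorm Y ^+ 2) * l2norm x ^+ 2.
Proof.
rewrite linearD /= mulmxDl; set u := X^T *m x; set w := Y^T *m x.
have -> : l2norm (u + w) ^+ 2 - l2norm u ^+ 2 =
    2 * (u^T *m w) 0 0 + l2norm w ^+ 2.
  by rewrite sqr_l2normD; ring.
have u_le : l2norm u <= opnorm X * l2norm x := l2norm_trmulmx X x.
have w_le : l2norm w <= opnorm Y * l2norm x := l2norm_trmulmx Y x.
apply: le_trans (ler_normD _ _) _.
rewrite normrM ger0_norm // (ger0_norm (sqr_ge0 _)) [X in _ <= X]mulrDl.
apply: lerD.
  rewrite -!mulrA ler_pM2l // [X in _ <= X](_ : _ =
    (opnorm X * l2norm x) * (opnorm Y * l2norm x)); last ring.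
  apply: le_trans (cauchy_schwarz _ _) _.
  by apply: ler_pM; rewrite ?l2norm_ge0.
rewrite -exprMn; apply: lerXn2r => //.
  by rewrite nnegrE l2norm_ge0.
by rewrite nnegrE mulr_ge0 ?opnorm_ge0 ?l2norm_ge0.
Qed.

(** The row space of [X] meets the kernel of [X^T] trivially: [v = w X] with [v X^T = 0] has |v|^2 =
    v X^T w^T = 0. *)
Lemma rank_gram (R : realType) p q (X : 'M[R]_(p, q)) :
  \rank (X *m X^T) = \rank X.
Proof.
rewrite -[RHS](mxrank_mul_ker X X^T) -[LHS]addn0; congr addn.
apply/esym/eqP; rewrite mxrank_eq0; apply/rowV0P => v.
rewrite sub_capmx => /andP[/submxP[w vE] /sub_kermxP vX].
apply: trmx_inj; rewrite trmx0; apply: l2norm_eq0; apply/eqP.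
by rewrite -sqrf_eq0 sqr_l2norm trmxK {2}vE trmx_mul mulmxA vX mul0mx mxE.
Qed.

(** Rank survives passing to [R[i]] and unitary conjugation, so it can be counted on the
    diagonal. *)
Lemma count_neq0_eigenvalues (R : realType) p (S : 'M[R]_p) : S^T = S ->
  count (predC1 0) (eigenvalues S) = \rank S.
Proof.
move=> /symmetric_spectral[d [P uP eqS]].
rewrite (permP (eigenvalues_spectral uP eqS)) -rank_diag_mx.
rewrite -(mxrank_map (real_complex R) S) eqS -invmx_unitary //.
have uP' := unitarymx_unit uP.
rewrite mxrankMfree ?row_free_unit //.
rewrite (eqmxMfull _ _) ?row_full_unit ?unitmx_inv //.
by rewrite -map_diag_mx mxrank_map.
Qed.

(** Weyl comparison with the zero matrix at [delta = 0]; that matrix has rank 0, so its eigenvalues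
    vanish. Positions from [p] on return the default 0. *)
Lemma gram_eigenvalues_ge0 (R : realType) p q (X : 'M[R]_(p, q)) i :
  0 <= nth 0 (eigenvalues (X *m X^T)) i.
Proof.
have [ip|ip] := ltnP i p; last first.
  by rewrite nth_default ?size_eigenvalues ?gram_sym.
have sym0 : (0 : 'M[R]_p)^T = 0 by rewrite trmx0.
have : nth 0 (eigenvalues (0 : 'M[R]_p)) i = 0.
  have := count_neq0_eigenvalues sym0; rewrite mxrank0 => /eqP.
  rewrite -leqn0 leqNgt -has_count -all_predC => /all_nthP-/(_ 0 i).
  by rewrite size_eigenvalues // => /(_ ip) /=; rewrite negbK => /eqP.
move=> {1}<-; rewrite -[leRHS]addr0.
apply: eigenvalues_le => // [|x]; first exact: gram_sym.
by rewrite mulmx0 mul0mx mxE mul0r addr0 gram_form sqr_ge0.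
Qed.

(** The list is nonincreasing and nonnegative, so its nonzero entries, [\rank X] in number, fill the
    leading positions. *)
Lemma gram_eigenvalues_gt0 (R : realType) p q (X : 'M[R]_(p, q)) i :
  (i < p)%N -> (0 < nth 0 (eigenvalues (X *m X^T)) i) = (i < \rank X)%N.
Proof.
move=> ip; set s := eigenvalues _.
have sz : size s = p by rewrite size_eigenvalues ?gram_sym.
have rkE : count (predC1 0) s = \rank X.
  by rewrite count_neq0_eigenvalues ?gram_sym // rank_gram.
have sorted_s : sorted >=%R s := eigenvalues_sorted _.
rewrite -rkE; apply/idP/idP => [gt0|].
  have lti : (i < size s)%N by rewrite sz.
  apply: leq_trans (sorted_count_ge sorted_s lti) _.
  by apply: sub_count => a /(lt_le_trans gt0) /=; rewrite lt_def => /andP[].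
(* An entry at most 0 at position [i] forces the last [p - i] entries to be 0, leaving at most [i]
   nonzero ones. *)
apply: contraTT; rewrite -leNgt -leqNgt => le0.
have := count_predC (pred1 (0%R : R)) s; rewrite sz.
suff : (p - i <= count (pred1 (0%R : R)) s)%N.
  rewrite (_ : count (predC (pred1 0%R)) s = count (predC1 0%R) s) //.
  by move=> h1 h2; lia.
rewrite -sz; apply: leq_trans (sorted_count_le i sorted_s) _.
rewrite leq_eqVlt; apply/orP; left; apply/eqP.
apply: eq_in_count => a /(nthP 0)[j _ <-] /=; apply/idP/eqP => [le_ji|->].
  by apply/eqP; rewrite eq_le gram_eigenvalues_ge0 (le_trans le_ji).
exact: gram_eigenvalues_ge0.
Qed.

(** * Perturbation of singular values *)

Lemma sigmaE (R : realType) p q (X : 'M[R]_(p, q)) i :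
  (1 <= i <= minn p q)%N ->
  sigma i X = Num.sqrt (nth 0 (eigenvalues (X *m X^T)) i.-1).
Proof.
case: i => // i /= ip; rewrite /sigma /singular_values nth_take //.
rewrite (nth_map 0) // size_eigenvalues ?gram_sym //.
exact: leq_trans ip (geq_minl _ _).
Qed.

(** A block row times its transpose has no mixed products, so the estimate is made block by block
    and summed. *)
Lemma mxrow_gram_perturb (R : realType) m n k (A At : 'I_k -> 'M[R]_(m, n))
    (x : 'rV[R]_m) :
  let M := \mxrow_(j < k) A j in let Mt := \mxrow_(j < k) At j in
  `|(x *m (Mt *m Mt^T) *m x^T) 0 0 - (x *m (M *m M^T) *m x^T) 0 0| <=
    (\sum_(j < k) (2 * opnorm (A j) * opnorm (At j - A j)
                   + opnorm (At j - A j) ^+ 2)) * (x *m x^T) 0 0.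
Proof.
have blockE (B : 'I_k -> 'M[R]_(m, n)) :
    (x *m (\mxrow_j B j *m (\mxrow_j B j)^T) *m x^T) 0 0 =
      \sum_j l2norm ((B j)^T *m x^T) ^+ 2.
  rewrite tr_mxrow mul_mxrow_mxcol mulmx_sumr mulmx_suml summxE.
  by apply: eq_bigr => j _; exact: gram_form.
rewrite /= !blockE -sumrB mulr_suml; apply: le_trans (ler_norm_sum _ _ _) _.
apply: ler_sum => j _.
have := sqr_l2normD_bound (A j) (At j - A j) x^T.
by rewrite (addrC (A j)) subrK [in X in _ <= X]sqr_l2norm trmxK.
Qed.

Lemma sqrt_dist_le (R : rcfType) (a b delta : R) : 0 < a -> 0 <= b ->
  `|b - a| <= delta ->
  `|Num.sqrt b - Num.sqrt a| <= (Num.sqrt a)^-1 * delta.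
Proof.
move=> a_gt0 b_ge0 le_ba; have sa : 0 < Num.sqrt a by rewrite sqrtr_gt0.
rewrite ler_pdivlMl // mulrC; apply: le_trans le_ba.
rewrite -{2}(sqr_sqrtr b_ge0) -{3}(sqr_sqrtr (ltW a_gt0)) subr_sqr normrM.
rewrite ler_wpM2l // ger0_norm ?addr_ge0 ?sqrtr_ge0 //.
by rewrite lerDr sqrtr_ge0.
Qed.

Theorem theorem2 (R : realType) (m n k : nat)
    (hm : (1 <= m)%N) (hn : (1 <= n)%N) (hk : (1 <= k)%N)
    (A At : 'I_k -> 'M[R]_(m, n)) :
  let M := \mxrow_(j < k) A j in
  let Mt := \mxrow_(j < k) At j in
  let r := \rank M in
  let E := fun j : 'I_k => At j - A j in
  let delta :=
    \sum_(j < k) (2 * opnorm (A j) * opnorm (E j) + opnorm (E j) ^+ 2) in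
  (forall i : nat, (1 <= i <= r)%N ->
     `|sigma i Mt - sigma i M| <= (sigma i M)^-1 * delta) /\
  (forall i : nat, (r + 1 <= i <= minn m (k * n))%N ->
     sigma i Mt <= Num.sqrt delta).
Proof.
move=> M Mt r E delta.
(* The type of [M] gives it width [\sum_(j < k) n], which equals [k * n] but is not convertible to
   it. *)
have widthE : (\sum_(j < k) n)%N = (k * n)%N by rewrite sum_nat_const card_ord.
have weyl i : (i < m)%N ->
    `|nth 0 (eigenvalues (Mt *m Mt^T)) i - nth 0 (eigenvalues (M *m M^T)) i|
      <= delta.
  (* The two sides of the absolute value come from [eigenvalues_le] with the Gram matrices
     exchanged. *)
  move=> im; rewrite ler_distl lerBlDr.
  by apply/andP; split; apply: eigenvalues_le; rewrite ?gram_sym // => x;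
    have := mxrow_gram_perturb A At x; rewrite /= ler_distl lerBlDr => /andP[].
split=> i.
  move=> /andP[i1 ir].
  have imin : (1 <= i <= minn m (\sum_(j < k) n))%N.
    rewrite i1 leq_min (leq_trans ir (rank_leq_row _)).
    by rewrite (leq_trans ir (rank_leq_col _)).
  (* [sigma] counts from 1 and the eigenvalue list from 0, so [i <= r] becomes [i.-1 < r], the range
     of positive eigenvalues. *)
  have im : (i.-1 < m)%N by rewrite prednK // (leq_trans ir (rank_leq_row _)).
  rewrite !sigmaE //; apply: sqrt_dist_le; last exact: weyl.
    by rewrite gram_eigenvalues_gt0 // prednK.
  exact: gram_eigenvalues_ge0.
rewrite addn1 => /andP[ri imin].
have i1 : (1 <= i)%N by apply: leq_trans ri.
have im : (i.-1 < m)%N.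
  by rewrite prednK // (leq_trans imin (geq_minl _ _)).
rewrite sigmaE ?widthE ?i1 //; apply: ler_wsqrtr.
(* Position [i.-1] is at or beyond the rank, so this eigenvalue is not positive, and nonnegativity
   makes it 0. *)
have lam0 : nth 0 (eigenvalues (M *m M^T)) i.-1 = 0.
  apply/eqP; rewrite eq_le gram_eigenvalues_ge0 andbT leNgt.
  by rewrite gram_eigenvalues_gt0 // prednK // -ltnNge.
by have := weyl _ im; rewrite lam0 subr0 => /(le_trans (ler_norm _)).
Qed.
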